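(* Let $E,F$ be two Lie algebroids over a smooth manifold $M$, and $K\colon E\to F$ a morphism of Lie algebroids. Then $E$ is a $K$-twisted action algebroid induced by some BLA structure on (the vector bundle) $E$ equipped with a strict YM $F$-connection if and only if $E$ admits a strict $K$-adjustment.
   Context: Everything is smooth. For a Lie algebroid $A\to M$, $\rho_A$ is its anchor and $[\cdot,\cdot]_A$ its bracket. Morphisms of Lie algebroids over $M$ cover the identity. A BLA (bundle of Lie algebras) is a vector bundle $E\to M$ with a smooth tensor field $H$ of Lie brackets on its fibres (field of Lie brackets); we then write $E_H$. For a Lie algebroid $F$ and a vector bundle $E$ over $M$, an $F$-connection on $E$ is an $\mathbb R$-bilinear map $\nabla\colon\Gamma(F)\times\Gamma(E)\to\Gamma(E)$, $C^\infty(M)$-linear in the first argument, with $\nabla_X(f\mu)=f\nabla_X\mu+(\rho_F(X)f)\mu$. Its curvature is $R_\nabla(X,Y)\mu=\nabla_X\nabla_Y\mu-\nabla_Y\nabla_X\mu-\nabla_{[X,Y]_F}\mu$. Put $\Omega^k(F;E)=\Gamma(\bigwedge^kF^*\otimes E)$; for $\zeta\in\Omega^2(F;E)$, $(\mathrm d^\nabla\zeta)(X,Y,Z)=\sum_{\mathrm{cyc}(X,Y,Z)}\bigl(\nabla_X(\zeta(Y,Z))-\zeta([X,Y]_F,Z)\bigr)$. Strict YM $F$-connection on a BLA $E_H$: a pair $(\nabla,\zeta)$ of an $F$-connection $\nabla$ on $E_H$ and $\zeta\in\Omega^2(F;E_H)$ with $\nabla H=0$ (i.e. $\nabla_X(H(\mu,\nu))=H(\nabla_X\mu,\nu)+H(\mu,\nabla_X\nu)$),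 $R_\nabla(X,Y)\nu=H(\zeta(X,Y),\nu)$, and $\mathrm d^\nabla\zeta=0$. A Lie algebroid $E$ is the $K$-twisted action algebroid induced by a BLA structure $H$ on the vector bundle $E$ and a strict YM $F$-connection $(\nabla',\zeta)$ on $E_H$ if $\rho_E=\rho_F\circ K$ and $[\mu,\nu]_E=H(\mu,\nu)+\nabla'_{K(\mu)}\nu-\nabla'_{K(\nu)}\mu+\zeta(K(\mu),K(\nu))$ for all $\mu,\nu\in\Gamma(E)$ (with $K\colon E\to F$ a morphism of Lie algebroids). For an $F$-connection $\nabla$ on the Lie algebroid $E$, the basic $K$-connection $\nabla^{\mathrm{bas}}$ is the pair of $E$-connections, on $E$ and on $F$, given by $\nabla^{\mathrm{bas}}_\mu\nu=[\mu,\nu]_E+\nabla_{K(\nu)}\mu$ and $\nabla^{\mathrm{bas}}_\mu X=[K(\mu),X]_F+K(\nabla_X\mu)$. $\nabla$ is a Cartan $K$-connection if for all $\mu,\nu\in\Gamma(E)$, $X\in\Gamma(F)$: $\nabla_X([\mu,\nu]_E)-[\nabla_X\mu,\nu]_E-[\mu,\nabla_X\nu]_E-\nabla_{\nabla^{\mathrm{bas}}_\nu X}\mu+\nabla_{\nabla^{\mathrm{bas}}_\mu X}\nu=0$. A strict $K$-adjustment on $E$ is a pair $(\nabla,\zeta)$ with $\nabla$ a Cartan $K$-connection and $\zeta\in\Omega^2(F;E)$ such that $R_\nabla(X,Y)\nu=-\nabla^{\mathrm{bas}}_\nu(\zeta(X,Y))+\zeta(\nabla^{\mathrm{bas}}_\nu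 X,Y)+\zeta(X,\nabla^{\mathrm{bas}}_\nu Y)$ for all $X,Y\in\Gamma(F)$, $\nu\in\Gamma(E)$, and $\mathrm d^{\nabla^\zeta}\zeta=0$, where $\nabla^\zeta_X\nu=\nabla_X\nu-\zeta(X,K(\nu))$. *)

(* Defs.v *)
From HB Require Import structures.
From mathcomp Require Import all_boot all_order all_algebra.
From mathcomp Require Import all_classical all_reals.
From mathcomp Require Import topology normedtype landau derive.

Set Implicit Arguments.
Unset Strict Implicit.
Unset Printing Implicit Defensive.

Import Order.TTheory GRing.Theory Num.Theory.
Import numFieldNormedType.Exports.

Local Open Scope classical_set_scope.
Local Open Scope ring_scope.

(* Meant for open [A]: values of [f] outside [A] are then irrelevant. *)
Fixpoint Ck (R : realType) (n k : nat) (A : set 'rV[R]_n) (f : 'rV[R]_n -> R)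
    : Prop :=
  match k with
  | 0 => forall p, A p -> {for p, continuous f}
  | k'.+1 => (forall p, A p -> differentiable f p) /\
             (forall v : 'rV[R]_n, Ck k' A ('D_v f))
  end.

Definition smooth_on (R : realType) (n : nat) (A : set 'rV[R]_n)
  (f : 'rV[R]_n -> R) : Prop := forall k, Ck k A f.

Section CkTheory.
Context {R : realType} {n : nat}.
Implicit Types (A B : set 'rV[R]_n) (f g : 'rV[R]_n -> R).

Lemma differentiable_near_eq f g p : (\near p, f p = g p) ->
  differentiable f p -> differentiable g p.
Proof.
move=> fg df.
have -> : g = f + (g - f) by rewrite addrC subrK.
apply: differentiableD => //.
have hn : \near p, (g - f) p = 0.
  by apply: filterS fg => q /= fgq; rewrite !fctE fgq subrr.
have hp : (g - f) p = 0 by exact: nbhs_singleton hn.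
apply/diffP => /=.
apply: (@getPex _ (fun (df : {linear 'rV[R]_n -> R}) => continuous df /\
  forall y, (g - f) y = (g - f) (lim (nbhs p)) + df (y - lim (nbhs p))
                  +o_(y \near p) (y - lim (nbhs p)))).
exists (GRing.null_fun _ : {linear 'rV[R]_n -> R}); split; first by move=> x; exact: cst_continuous.
apply: (eqaddoEx (h := g - f)) => y; rewrite lim_id// hp /= addr0 add0r.
rewrite littleoE// => e e0.
by apply: filterS hn => q /= ->; rewrite normr0 mulr_ge0// ltW.
Qed.

Lemma Ck_sub k A B f : B `<=` A -> Ck k A f -> Ck k B f.
Proof.
elim: k f => [|k IH] f BA /=; first by move=> h p /BA/h.
by move=> [d D]; split=> [p /BA/d//|v]; apply: IH.
Qed.

Lemma Ck_loc k A f :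
  (forall p, A p -> exists B, B p /\ Ck k B f) -> Ck k A f.
Proof.
elim: k f => [|k IH] f h /=.
  by move=> p /h [B [Bp hB]]; exact: hB.
split=> [p /h [B [Bp [d _]]]|v]; first exact: d.
apply: IH => p /h [B [Bp [_ D]]]; exists B; split=> //; exact: D.
Qed.

Lemma Ck_ext k A f g : open A -> (forall p, A p -> f p = g p) ->
  Ck k A f -> Ck k A g.
Proof.
move=> oA; elim: k f g => [|k IH] f g fg /=.
  move=> h p Ap; have nfg : {near p, f =1 g}.
    by move/open_nbhs_nbhs: (conj oA Ap); apply: filterS.
  rewrite /prop_for /continuous_at -(fg _ Ap).
  exact: cvg_trans (near_eq_cvg nfg) (h p Ap).
move=> [d D]; split=> [p Ap|v].
  apply: differentiable_near_eq (d p Ap).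
  by move/open_nbhs_nbhs: (conj oA Ap); apply: filterS.
apply: IH (D v) => p Ap; apply: near_eq_derive.
by move/open_nbhs_nbhs: (conj oA Ap); apply: filterS.
Qed.

Lemma Ck_cst k A (c : R) : Ck k A (cst c).
Proof.
elim: k c => [|k IH] c /=; first by move=> p _; exact: cst_continuous.
split=> [p _|v]; first exact: differentiable_cst.
have -> : 'D_v (cst c) = cst 0 by apply/funext => p; rewrite derive_cst.
exact: IH.
Qed.

Lemma CkW k A f : Ck k.+1 A f -> Ck k A f.
Proof.
elim: k f => [|k IH] f.
  by move=> [d _] p /d; exact: differentiable_continuous.
by move=> [d D]; split=> // v; apply: IH; exact: D.
Qed.

Lemma Ck_add k A f g : open A -> Ck k A f -> Ck k A g ->
  Ck k A (fun p => f p + g p).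
Proof.
move=> oA; elim: k f g => [|k IH] f g /=.
  by move=> hf hg p Ap; apply: continuousD; [exact: hf|exact: hg].
move=> [df Df] [dg Dg]; split=> [p Ap|v].
  by apply: differentiableD; [exact: df|exact: dg].
apply: Ck_ext (IH _ _ (Df v) (Dg v)) => // p Ap.
by rewrite -deriveD//; apply: diff_derivable; [exact: df|exact: dg].
Qed.

Lemma Ck_mul k A f g : open A -> Ck k A f -> Ck k A g ->
  Ck k A (fun p => f p * g p).
Proof.
move=> oA; elim: k f g => [|k IH] f g.
  by move=> hf hg p Ap; apply: continuousM; [exact: hf|exact: hg].
move=> hf hg; have [hf' hg'] := (CkW hf, CkW hg).
case: hf hg => df Df [dg Dg]; split=> [p Ap|v].
  by apply: differentiableM; [exact: df|exact: dg].
have := Ck_add oA (IH _ _ hf' (Dg v)) (IH _ _ hg' (Df v)).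
apply: Ck_ext => // p Ap.
by rewrite -[RHS]/('D_v (f * g) p) deriveM//;
   apply: diff_derivable; [exact: df|exact: dg].
Qed.

End CkTheory.

(* A Hausdorff second countable space with a smooth atlas. The total functions
   [chart c] and [chartV c] matter only on [cdom c] and on its image [cimg c];
   transition maps are smooth coordinate by coordinate. *)
Record manifold (R : realType) := Manifold {
  carrier :> topologicalType;
  dim : nat;
  cidx : Type;
  cdom : cidx -> set carrier;
  cimg : cidx -> set 'rV[R]_dim;
  chart : cidx -> carrier -> 'rV[R]_dim;
  chartV : cidx -> 'rV[R]_dim -> carrier;
  carrier_hausdorff : hausdorff_space carrier;
  carrier_second_countable : @second_countable carrier;
  cdom_open : forall c, open (cdom c);
  cimg_open : forall c, open (cimg c);
  cdom_cover : forall x, exists c, cdom c x;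
  chart_img : forall c x, cdom c x -> cimg c (chart c x);
  chartV_dom : forall c p, cimg c p -> cdom c (chartV c p);
  chartK : forall c x, cdom c x -> chartV c (chart c x) = x;
  chartVK : forall c p, cimg c p -> chart c (chartV c p) = p;
  chart_continuous : forall c x, cdom c x -> {for x, continuous (chart c)};
  chartV_continuous : forall c p, cimg c p -> {for p, continuous (chartV c)};
  chart_smooth : forall c c' k,
    smooth_on (cimg c `&` chartV c @^-1` cdom c')
              (fun p => chart c' (chartV c p) 0 k)
}.

Definition smoothM (R : realType) (M : manifold R) (A : set M) (f : M -> R) :=
  forall c : cidx M,
    smooth_on (cimg c `&` chartV c @^-1` A) (fun p => f (chartV c p)).

Section SmoothM.
Context {R : realType} {M : manifold R}.
Implicit Types (A B : set M) (f g : M -> R).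

Lemma open_cimg A c : open A -> open (cimg c `&` @chartV R M c @^-1` A).
Proof.
move=> oA; rewrite openE => p [cp Ap]; apply: filterI.
  by apply: open_nbhs_nbhs; split=> //; exact: cimg_open.
by apply: chartV_continuous => //; exact: open_nbhs_nbhs.
Qed.

Lemma smoothM_sub A B f : B `<=` A -> smoothM A f -> smoothM B f.
Proof. by move=> BA h c k; apply: Ck_sub (h c k) => p [cp /BA]. Qed.

Lemma smoothM_loc A f :
  (forall x, A x -> exists B, B x /\ smoothM B f) -> smoothM A f.
Proof.
move=> h c k; apply: Ck_loc => p [cp /h [B [Bx hB]]].
by exists (cimg c `&` chartV c @^-1` B); split=> //; exact: hB.
Qed.

Lemma smoothM_ext A f g : open A -> (forall x, A x -> f x = g x) ->
  smoothM A f -> smoothM A g.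
Proof.
move=> oA fg h c k; apply: Ck_ext (h c k); first exact: open_cimg oA.
by move=> p [_ /fg].
Qed.

Lemma smoothM_cst A r : smoothM A (fun=> r).
Proof. by move=> c k; exact: Ck_cst. Qed.

Lemma smoothM_add A f g : open A -> smoothM A f -> smoothM A g ->
  smoothM A (fun x => f x + g x).
Proof.
by move=> oA hf hg c k; apply: Ck_add (hf c k) (hg c k); exact: open_cimg oA.
Qed.

Lemma smoothM_mul A f g : open A -> smoothM A f -> smoothM A g ->
  smoothM A (fun x => f x * g x).
Proof.
by move=> oA hf hg c k; apply: Ck_mul (hf c k) (hg c k); exact: open_cimg oA.
Qed.

Lemma smoothM_opp A f : open A -> smoothM A f -> smoothM A (fun x => - f x).
Proof.
move=> oA hf; apply: smoothM_ext (smoothM_mul oA (smoothM_cst A (-1)) hf) => //.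
by move=> x _; rewrite mulN1r.
Qed.

Lemma smoothM_sum A (I : finType) (F : I -> M -> R) : open A ->
  (forall i, smoothM A (F i)) -> smoothM A (fun x => \sum_i F i x).
Proof.
move=> oA hF; elim: (index_enum I) => [|i s IH].
  by apply: smoothM_ext (smoothM_cst A 0) => // x _; rewrite big_nil.
apply: smoothM_ext (smoothM_add oA (hF i) IH) => // x _.
by rewrite big_cons.
Qed.

End SmoothM.

(* C^oo(M) *)
Record cinf (R : realType) (M : manifold R) := Cinf {
  cinf_fun :> M -> R;
  cinf_smooth : smoothM setT cinf_fun
}.

Section CinfRing.
Context {R : realType} {M : manifold R}.
Implicit Types f g h : cinf M.

HB.instance Definition _ := gen_eqMixin (cinf M).
HB.instance Definition _ := gen_choiceMixin (cinf M).

Lemma cinfP f g : (forall x, f x = g x) -> f = g.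
Proof.
case: f g => [f hf] [g hg] /= /funext fg; case: _ / fg in hg *.
by congr Cinf; exact: Prop_irrelevance.
Qed.

Definition cinf_cst (r : R) : cinf M := Cinf (smoothM_cst setT r).
Definition cinf_add f g : cinf M :=
  Cinf (smoothM_add openT (cinf_smooth f) (cinf_smooth g)).
Definition cinf_opp f : cinf M := Cinf (smoothM_opp openT (cinf_smooth f)).
Definition cinf_mul f g : cinf M :=
  Cinf (smoothM_mul openT (cinf_smooth f) (cinf_smooth g)).

Fact cinf_addA : associative cinf_add.
Proof. by move=> f g h; apply: cinfP => x /=; rewrite addrA. Qed.
Fact cinf_addC : commutative cinf_add.
Proof. by move=> f g; apply: cinfP => x /=; rewrite addrC. Qed.
Fact cinf_add0 : left_id (cinf_cst 0) cinf_add.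
Proof. by move=> f; apply: cinfP => x /=; rewrite add0r. Qed.
Fact cinf_addN : left_inverse (cinf_cst 0) cinf_opp cinf_add.
Proof. by move=> f; apply: cinfP => x /=; rewrite addNr. Qed.
Fact cinf_mulA : associative cinf_mul.
Proof. by move=> f g h; apply: cinfP => x /=; rewrite mulrA. Qed.
Fact cinf_mulC : commutative cinf_mul.
Proof. by move=> f g; apply: cinfP => x /=; rewrite mulrC. Qed.
Fact cinf_mul1 : left_id (cinf_cst 1) cinf_mul.
Proof. by move=> f; apply: cinfP => x /=; rewrite mul1r. Qed.
Fact cinf_mulD : left_distributive cinf_mul cinf_add.
Proof. by move=> f g h; apply: cinfP => x /=; rewrite mulrDl. Qed.

HB.instance Definition _ := GRing.isZmodule.Build (cinf M)
  cinf_addA cinf_addC cinf_add0 cinf_addN.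
(* Possibly trivial ring: [M] may be empty. *)
HB.instance Definition _ := GRing.Zmodule_isComPzRing.Build (cinf M)
  cinf_mulA cinf_mulC cinf_mul1 cinf_mulD.

End CinfRing.

(* A vector bundle, given by its fibres and by local trivialisations
   [triv i x : E_x -> R^r], with inverse [trivV i x], over the open sets
   [tdom i]; they are related by smooth transition matrices. The topology and
   the smooth structure of the total space are those making the local
   trivialisations diffeomorphisms. The rank is only locally constant. *)
Record bundle (R : realType) (M : manifold R) := Bundle {
  fibre :> M -> lmodType R;
  tidx : Type;
  tdom : tidx -> set M;
  trk : tidx -> nat;
  triv : forall (i : tidx) (x : M), {linear fibre x -> 'rV[R]_(trk i)};
  trivV : forall (i : tidx) (x : M), {linear 'rV[R]_(trk i) -> fibre x};
  tdom_open : forall i, open (tdom i);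
  tdom_cover : forall x, exists i, tdom i x;
  trivK : forall i x, tdom i x -> cancel (triv i x) (trivV i x);
  trivVK : forall i x, tdom i x -> cancel (trivV i x) (triv i x);
  triv_smooth : forall i j w k,
    smoothM (tdom i `&` tdom j) (fun x => triv j x (trivV i x w) 0 k)
}.

Definition smoothS (R : realType) (M : manifold R) (E : bundle M) (A : set M)
    (s : forall x, E x) :=
  forall (i : tidx E) k,
    smoothM (A `&` tdom i) (fun x => triv i x (s x) 0 k).

(* Gamma(E) *)
Record section (R : realType) (M : manifold R) (E : bundle M) := Section {
  section_fun :> forall x, E x;
  section_smooth : smoothS setT section_fun
}.

Section SectionModule.
Context {R : realType} {M : manifold R} {E : bundle M}.
Implicit Types (f g : cinf M) (s t u : section E).

HB.instance Definition _ := gen_eqMixin (section E).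
HB.instance Definition _ := gen_choiceMixin (section E).

Lemma sectionP s t : (forall x, s x = t x) -> s = t.
Proof.
case: s t => [s hs] [t ht] /= st0.
have st : s = t by apply: functional_extensionality_dep.
by case: _ / st {st0} in ht *; congr Section; exact: Prop_irrelevance.
Qed.

Lemma open_tdom A (i : tidx E) : open A -> open (A `&` tdom i).
Proof. by move=> oA; apply: openI => //; exact: tdom_open. Qed.

Fact section_zero_smooth : smoothS setT (fun x => 0 : E x).
Proof.
move=> i k; apply: smoothM_ext (smoothM_cst _ 0) => [|x _].
  exact/open_tdom/openT.
by rewrite linear0 mxE.
Qed.

Fact section_add_smooth s t : smoothS setT (fun x => s x + t x).
Proof.
move=> i k; have oA := open_tdom i openT.
apply: smoothM_ext (smoothM_add oA (section_smooth s k) (section_smooth t k)).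
  exact: oA.
by move=> x _; rewrite linearD mxE.
Qed.

Fact section_opp_smooth s : smoothS setT (fun x => - s x).
Proof.
move=> i k; have oA := open_tdom i openT.
apply: smoothM_ext (smoothM_opp oA (section_smooth s k)); first exact: oA.
by move=> x _; rewrite linearN mxE.
Qed.

Fact section_scale_smooth f s : smoothS setT (fun x => f x *: s x).
Proof.
move=> i k; have oA := open_tdom i openT.
have hf := smoothM_sub (@subsetT _ (setT `&` tdom i)) (cinf_smooth f).
apply: smoothM_ext (smoothM_mul oA hf (section_smooth s k)); first exact: oA.
by move=> x _; rewrite linearZ mxE.
Qed.

Definition section_zero : section E := Section section_zero_smooth.
Definition section_add s t : section E := Section (section_add_smooth s t).
Definition section_opp s : section E := Section (section_opp_smooth s).
Definition section_scale f s : section E := Section (section_scale_smooth f s).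

Fact section_addA : associative section_add.
Proof. by move=> s t u; apply: sectionP => x /=; rewrite addrA. Qed.
Fact section_addC : commutative section_add.
Proof. by move=> s t; apply: sectionP => x /=; rewrite addrC. Qed.
Fact section_add0 : left_id section_zero section_add.
Proof. by move=> s; apply: sectionP => x /=; rewrite add0r. Qed.
Fact section_addN : left_inverse section_zero section_opp section_add.
Proof. by move=> s; apply: sectionP => x /=; rewrite addNr. Qed.

HB.instance Definition _ := GRing.isZmodule.Build (section E)
  section_addA section_addC section_add0 section_addN.

Fact section_scaleA f g s :
  section_scale f (section_scale g s) = section_scale (f * g) s.
Proof. by apply: sectionP => x /=; rewrite scalerA. Qed.
Fact section_scale1 : left_id 1 section_scale.
Proof. by move=> s; apply: sectionP => x /=; rewrite scale1r. Qed.
Fact section_scaleDr : right_distributive section_scale +%R.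
Proof. by move=> f s t; apply: sectionP => x /=; rewrite scalerDr. Qed.
Fact section_scaleDl s : {morph section_scale^~ s : f g / f + g}.
Proof. by move=> f g; apply: sectionP => x /=; rewrite scalerDl. Qed.

HB.instance Definition _ := GRing.Zmodule_isLmodule.Build (cinf M) (section E)
  section_scaleA section_scale1 section_scaleDr section_scaleDl.

Lemma section_frame s i x : tdom i x ->
  s x = \sum_k triv i x (s x) 0 k *: trivV i x (delta_mx 0 k).
Proof.
move=> ix; rewrite -[LHS](trivK ix) [X in trivV i x X]row_sum_delta.
by rewrite linear_sum; apply: eq_bigr => k _; rewrite linearZ.
Qed.

End SectionModule.

(* Smoothness is tested on the local frames of the source. *)
Record bmap (R : realType) (M : manifold R) (E F : bundle M) := Bmap {
  bmap_fun :> forall x, {linear E x -> F x};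
  bmap_smooth : forall (i : tidx E) w,
    smoothS (tdom i) (fun x => bmap_fun x (trivV i x w))
}.

(* Smooth bilinear bundle maps, i.e. sections of F^* (x) F^* (x) E *)
Record bilmap (R : realType) (M : manifold R) (F E : bundle M) := Bilmap {
  bil_fun :> forall x, F x -> F x -> E x;
  bil_linearl : forall x (v : F x), linear (fun u : F x => bil_fun u v);
  bil_linearr : forall x (u : F x), linear (@bil_fun x u);
  bil_smooth : forall (i j : tidx F) w w',
    smoothS (tdom i `&` tdom j)
            (fun x => bil_fun (trivV i x w) (trivV j x w'))
}.

Section MapsOnSections.
Context {R : realType} {M : manifold R}.

Fact bmap_section_smooth (E F : bundle M) (K : bmap E F) (s : section E) :
  smoothS setT (fun x => K x (s x)).
Proof.
move=> j k; apply: smoothM_loc => x [_ jx].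
have [i ix] := tdom_cover E x.
exists (tdom i `&` tdom j); split => //.
have oB : open (tdom i `&` tdom j) by exact: open_tdom (tdom_open i).
have hs l : smoothM (tdom i `&` tdom j) (fun y => triv i y (s y) 0 l).
  by apply: smoothM_sub (section_smooth s l) => y [].
have := smoothM_sum oB (fun l =>
  smoothM_mul oB (hs l) (@bmap_smooth _ _ _ _ K i (delta_mx 0 l) j k)).
apply: smoothM_ext => // y [iy jy].
rewrite [s y in RHS](section_frame s iy) !linear_sum summxE.
by apply: eq_bigr => l _; rewrite !linearZ mxE.
Qed.

Definition bmap_section E F (K : bmap E F) (s : section E) : section F :=
  Section (bmap_section_smooth K s).

Fact bil_section_smooth (F E : bundle M) (B : bilmap F E) (s t : section F) :
  smoothS setT (fun x => B x (s x) (t x)).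
Proof.
move=> j k; apply: smoothM_loc => x [_ jx].
have [i ix] := tdom_cover F x.
exists (tdom i `&` tdom j); split => //.
have oB : open (tdom i `&` tdom j) by exact: open_tdom (tdom_open i).
have hs (r : section F) l :
    smoothM (tdom i `&` tdom j) (fun y => triv i y (r y) 0 l).
  by apply: smoothM_sub (section_smooth r l) => y [].
have hb l m : smoothM (tdom i `&` tdom j) (fun y => triv j y
    (B y (trivV i y (delta_mx 0 l)) (trivV i y (delta_mx 0 m))) 0 k).
  have := @bil_smooth _ _ _ _ B i i (delta_mx 0 l) (delta_mx 0 m) j k.
  by apply: smoothM_sub => y [].
have := smoothM_sum oB (fun l => smoothM_mul oB (hs s l)
  (smoothM_sum oB (fun m => smoothM_mul oB (hs t m) (hb l m)))).
apply: smoothM_ext => // y [iy jy].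
pose Bl (v : F y) := GRing.isLinear.Build R (F y) (E y) _ _ (bil_linearl B v).
pose Br (u : F y) := GRing.isLinear.Build R (F y) (E y) _ _ (bil_linearr B u).
pose bl v : {linear F y -> E y} := HB.pack (fun u => B y u v) (Bl v).
pose br u : {linear F y -> E y} := HB.pack (B y u) (Br u).
rewrite [s y in RHS](section_frame s iy) -[B y _ _ in RHS]/(bl (t y) _).
rewrite !linear_sum summxE; apply: eq_bigr => l _; rewrite !linearZ mxE.
congr (_ * _); rewrite /= [t y in RHS](section_frame t iy).
rewrite -[B y _ _ in RHS]/(br _ _) !linear_sum summxE.
by apply: eq_bigr => m _; rewrite !linearZ mxE.
Qed.

Definition bil_section F E (B : bilmap F E) (s t : section F) : section E :=
  Section (bil_section_smooth B s t).

End MapsOnSections.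

(* Omega^2(F; E) *)
Record form2 (R : realType) (M : manifold R) (F E : bundle M) := Form2 {
  form2_bil :> bilmap F E;
  form2_alt : forall x (u : F x), form2_bil x u u = 0
}.

(* A smooth field of Lie brackets: [(E, H)] is a bundle of Lie algebras. *)
Record bla (R : realType) (M : manifold R) (E : bundle M) := Bla {
  bla_bil :> bilmap E E;
  bla_alt : forall x (u : E x), bla_bil x u u = 0;
  bla_jacobi : forall x (u v w : E x),
    bla_bil x u (bla_bil x v w) + bla_bil x v (bla_bil x w u)
    + bla_bil x w (bla_bil x u v) = 0
}.

(* A smooth bundle map E -> TM; tangent vectors at [x] are the R-linear
   derivations at [x] of C^oo(M). *)
Record anchor_map (R : realType) (M : manifold R) (E : bundle M) := AnchorMap {
  anchor_fun :> forall x, E x -> cinf M -> R;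
  anchor_linear : forall x f, scalar (fun u : E x => anchor_fun u f);
  anchor_derD : forall x (u : E x) f g,
    anchor_fun u (f + g) = anchor_fun u f + anchor_fun u g;
  anchor_derZ : forall x (u : E x) r f,
    anchor_fun u (cinf_cst r * f) = r * anchor_fun u f;
  anchor_derM : forall x (u : E x) f g,
    anchor_fun u (f * g) = f x * anchor_fun u g + g x * anchor_fun u f;
  anchor_smooth : forall (i : tidx E) w f,
    smoothM (tdom i) (fun x => anchor_fun (trivV i x w) f)
}.

Section AnchorOnSections.
Context {R : realType} {M : manifold R} {E : bundle M}.

Fact anchor_section_smooth (a : anchor_map E) (s : section E) (f : cinf M) :
  smoothM setT (fun x => a x (s x) f).
Proof.
apply: smoothM_loc => x _.
have [i ix] := tdom_cover E x.
exists (tdom i); split => //; have oB := tdom_open i.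
have hs l : smoothM (tdom i) (fun y => triv i y (s y) 0 l).
  by apply: smoothM_sub (section_smooth s l) => y.
have := smoothM_sum oB (fun l =>
  smoothM_mul oB (hs l) (@anchor_smooth _ _ _ a i (delta_mx 0 l) f)).
apply: smoothM_ext => // y iy.
pose Al := GRing.isLinear.Build R (E y) R _ _ (@anchor_linear _ _ _ a y f).
pose al : {scalar E y} := HB.pack (fun u => a y u f) Al.
rewrite [s y in RHS](section_frame s iy) -[a y _ _ in RHS]/(al _).
by rewrite linear_sum; apply: eq_bigr => l _; rewrite linearZ.
Qed.

(* [rho(s) f] *)
Definition anchor_section (a : anchor_map E) (s : section E) (f : cinf M) :
  cinf M := Cinf (anchor_section_smooth a s f).

(* [section E] is a module over [cinf M]: real scalars enter as constant
   functions. *)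
Definition Rlinear (E' : bundle M) (phi : section E -> section E') :=
  forall (r : R) s t,
    phi (cinf_cst r *: s + t) = cinf_cst r *: phi s + phi t.

End AnchorOnSections.

(* That the anchor preserves brackets follows from these axioms. *)
Record algebroid (R : realType) (M : manifold R) := Algebroid {
  vb :> bundle M;
  anchor : anchor_map vb;
  bracket : section vb -> section vb -> section vb;
  bracket_linearl : forall t, Rlinear (bracket^~ t);
  bracket_linearr : forall s, Rlinear (bracket s);
  bracket_alt : forall s, bracket s s = 0;
  bracket_jacobi : forall s t u,
    bracket s (bracket t u) + bracket t (bracket u s)
    + bracket u (bracket s t) = 0;
  bracket_leibniz : forall s f t,
    bracket s (f *: t) = f *: bracket s t + anchor_section anchor s f *: t
}.

Record algebroid_morphism (R : realType) (M : manifold R) (E F : algebroid M) :=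
  AlgebroidMorphism {
  mor_bmap :> bmap E F;
  mor_anchor : forall x (u : E x) f, anchor F x (mor_bmap x u) f = anchor E x u f;
  mor_bracket : forall s t,
    bmap_section mor_bmap (bracket s t)
    = bracket (bmap_section mor_bmap s) (bmap_section mor_bmap t)
}.

Record connection (R : realType) (M : manifold R) (F : algebroid M)
    (E : bundle M) := Connection {
  nabla :> section F -> section E -> section E;
  nabla_linearl : forall s, linear (nabla^~ s);
  nabla_linearr : forall X, Rlinear (nabla X);
  nabla_leibniz : forall X f s,
    nabla X (f *: s) = f *: nabla X s + anchor_section (anchor F) X f *: s
}.

Section Definitions.
Context {R : realType} {M : manifold R}.

Section Connections.
Context {F : algebroid M} {E : bundle M}.
Implicit Types (D : section F -> section E -> section E).

Definition curvature D X Y s :=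
  D X (D Y s) - D Y (D X s) - D (bracket X Y) s.

Definition dnabla D (z : form2 F E) X Y Z :=
  let summand X Y Z :=
    D X (bil_section z Y Z) - bil_section z (bracket X Y) Z in
  summand X Y Z + summand Y Z X + summand Z X Y.

Definition strict_YM (H : bla E) (D : connection F E) (z : form2 F E) :=
  [/\ forall X s t, D X (bil_section H s t)
        = bil_section H (D X s) t + bil_section H s (D X t),
      forall X Y s, curvature D X Y s = bil_section H (bil_section z X Y) s
    & forall X Y Z, dnabla D z X Y Z = 0].

End Connections.

Context {E F : algebroid M} (K : algebroid_morphism E F).

Definition twisted_action (H : bla E) (D : connection F E) (z : form2 F E) :=
  (forall x (u : E x) f, anchor E x u f = anchor F x (K x u) f) /\
  forall s t : section E,
    bracket s t = bil_section H s t + D (bmap_section K s) t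
      - D (bmap_section K t) s
      + bil_section z (bmap_section K s) (bmap_section K t).

Definition basicE (D : connection F E) (s t : section E) : section E :=
  bracket s t + D (bmap_section K t) s.

Definition basicF (D : connection F E) (s : section E) (X : section F) :
  section F := bracket (bmap_section K s) X + bmap_section K (D X s).

Definition Cartan (D : connection F E) :=
  forall (s t : section E) (X : section F),
    D X (bracket s t) - bracket (D X s) t - bracket s (D X t)
    - D (basicF D t X) s + D (basicF D s X) t = 0.

Definition nabla_form (D : connection F E) (z : form2 F E) (X : section F)
  (s : section E) : section E := D X s - bil_section z X (bmap_section K s).

Definition strict_adjustment (D : connection F E) (z : form2 F E) :=
  [/\ Cartan D,
      forall X Y s, curvature D X Y s
        = - basicE D s (bil_section z X Y)
          + bil_section z (basicF D s X) Y + bil_section z X (basicF D s Y)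
    & forall X Y Z, dnabla (nabla_form D z) z X Y Z = 0].

End Definitions.

(* Main.v *)
Require Import Defs.
From mathcomp Require Import all_boot all_order all_algebra.
From mathcomp Require Import all_classical all_reals.
From HB Require Import structures.
From mathcomp Require Import topology normedtype derive sequences realfun exp.
From mathcomp Require Import ring lra.

(** The two structures determine each other through the change of connection
    [D X s = D' X s + z(X, K s)]: here [D] is the connection of the adjustment,
    [D'] (which is [nabla_form K D z]) the strict YM connection, and the
    2-form [z] is the same on both sides. Solving the twisted action formula
    for the bracket field gives
    [H(s, t) = [s, t] - D'_{K s} t + D'_{K t} s - z(K s, K t)].

    Write [C(X, Y) s = R_{D'}(X, Y) s - H(z(X, Y), s)] and [D'_X H] for the
    obstructions to two of the strict YM equations. Expanding every bracket of
    [E] by the twisted action formula yields three identities: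
    - the obstruction to the curvature equation of an adjustment is
      [C(X, Y) s + (d z)(X, Y, K s)] ([adjustment_curvature]);
    - the obstruction to the Cartan equation is
      [(D'_X H)(s, t) + C(X, K s) t - C(X, K t) s + (d z)(X, K s, K t)]
      ([adjustment_Cartan]);
    - the Jacobiator of [E] is the Jacobiator of [H] plus the cyclic sums of
      [(D'_{K s} H)(t, u)] and [C(K s, K t) u] plus [(d z)(K s, K t, K u)]
      ([bracket_jacobiator]),
    where [d] is taken with respect to [D']. So strict YM equations imply the
    adjustment equations. Conversely, with [d z = 0] the first identity gives
    [C = 0], then the second [D' H = 0], then the third the Jacobi identity of
    [H].

    In the converse direction [H] is only given as an operation on sections; it
    is bilinear over the smooth functions, because the derivative terms of the
    Leibniz rules cancel ([K] respects the anchors). That it comes from a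
    smooth tensor field ([tensor_bilmap]) rests on bump functions
    ([exists_bump]): they turn local frames into global sections, which shows
    that the value at a point depends only on the values of the arguments there
    and that every vector extends to a global section. *)

Set Implicit Arguments.
Unset Strict Implicit.
Unset Printing Implicit Defensive.

Import Order.TTheory GRing.Theory Num.Theory.
Import numFieldNormedType.Exports.

Local Open Scope classical_set_scope.
Local Open Scope ring_scope.

(** * A flat function on the real line *)

(** [flat 0] is the classical smooth function [exp (- 1 / t)]. The extra powers
    of [1 / t] make the family closed under derivation ([is_derive_flat]), so
    that smoothness of [flat 0] follows by induction on the order. *)
Definition flat (R : realType) (m : nat) (t : R) : R :=
  if 0 < t then t ^- m * expR (- t^-1) else 0.

Section Flat.
Context {R : realType}.
Implicit Types (m : nat) (t : R).

Lemma flat_gt0 m t : 0 < t -> 0 < flat m t.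
Proof.
by move=> t0; rewrite /flat t0 mulr_gt0 ?expR_gt0 ?invr_gt0 ?exprn_gt0.
Qed.

Lemma flat_le0 m t : t <= 0 -> flat m t = 0.
Proof. by move=> t0; rewrite /flat ltNge t0. Qed.

(** With [N = m + 2], [exp (1 / t) >= (1 + 1 / (N t)) ^ N >= (N t) ^ - N]. The
    quadratic bound is what makes the derivative at the origin vanish. *)
Lemma flat_le_sqr m t : `|flat m t| <= m.+2%:R ^+ m.+2 * t ^+ 2.
Proof.
have C0 : 0 <= m.+2%:R ^+ m.+2 * t ^+ 2.
  by rewrite mulr_ge0 ?sqr_ge0 ?exprn_ge0 ?ler0n.
have [t0|t0] := leP t 0; first by rewrite flat_le0// normr0.
rewrite gtr0_norm ?flat_gt0// /flat t0 expRN.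
have e0 : 0 < expR t^-1 by exact: expR_gt0.
have Nt0 : 0 < m.+2%:R * t by rewrite mulr_gt0 ?ltr0n.
have h : (m.+2%:R * t) ^- m.+2 <= expR t^-1.
  have -> : t^-1 = m.+2%:R * (m.+2%:R * t)^-1.
    by rewrite invfM mulrA divff ?mul1r ?pnatr_eq0.
  rewrite expRM_natl -exprVn lerXn2r ?nnegrE ?expR_ge0 ?invr_ge0 ?(ltW Nt0)//.
  by apply: le_trans (expR_ge1Dx _); rewrite lerDr.
rewrite ler_pdivrMr//.
apply: le_trans (ler_wpM2l C0 h).
rewrite exprMn invfM mulrACA divff ?mul1r ?expf_neq0 ?pnatr_eq0//.
by rewrite -[m.+2]addn2 addnC exprD invfM mulrA divff ?mul1r ?expf_neq0 ?gt_eqF.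
Qed.

Lemma is_derive_flat m t :
  is_derive t 1 (flat m) (flat m.+2 t - m%:R * flat m.+1 t).
Proof.
have [t0|t0|->] := ltgtP t 0.
- rewrite !flat_le0 ?ltW// mulr0 subr0.
  apply: (@near_eq_is_derive _ _ _ (cst 0)).
  by near=> s; rewrite /= flat_le0// ltW//; near: s; exact: lt_nbhsl.
- apply: (@near_eq_is_derive _ _ _ (fun s : R => (s^-1) ^+ m * expR (- s^-1))).
    near=> s; rewrite /flat; have -> : 0 < s by near: s; exact: lt_nbhsr.
    by rewrite exprVn.
  have tn0 : t != 0 by rewrite gt_eqF.
  have dV : is_derive t 1 (fun s : R => s^-1) (- t ^- 2).
    apply: DeriveDef; first exact: derivableV.
    by rewrite deriveV// derive_id scaler1.
  have dX : is_derive t 1 (fun s : R => s^-1 ^+ m)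
      (- (m%:R * t^-1 ^+ m.+1)).
    have := @is_deriveX _ _ _ m _ _ _ dV; rewrite exprfctE => dm.
    apply: (is_derive_eq dm).
    case: m {dV dm} => [|m]; first by rewrite !mul0r scale0r oppr0.
    by rewrite /= -exprVn /GRing.scale/= !exprS; ring.
  have dE : is_derive t 1 (fun s : R => expR (- s^-1))
      (expR (- t^-1) * t ^- 2).
    have := @is_derive1_comp _ expR (fun s : R => - s^-1) t _ _
      (is_derive_expR _) (@is_deriveN _ _ _ _ _ _ _ dV).
    by rewrite opprK.
  have := @is_deriveM _ _ _ _ _ _ _ _ dX dE => dXE.
  apply: (is_derive_eq dXE).
  by rewrite /flat t0 /GRing.scale/= -!exprVn !exprS; ring.
- rewrite !flat_le0// mulr0 subr0.
  suff h : (fun h : R => h^-1 *: ((flat m \o shift 0) (h *: 1) - flat m 0))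
      @ 0^' --> (0 : R).
    by apply: DeriveDef; [apply/cvg_ex; exists 0|exact: cvg_lim h].
  (* The difference quotient at [h] is bounded by [C * h] in absolute value. *)
  pose C : R := m.+2%:R ^+ m.+2.
  have hC : (fun h : R => C * h) @ 0^' --> (0 : R).
    rewrite -[X in _ --> X](mulr0 C); apply: cvgMr.
    exact: cvg_within.
  apply/cvgr0Pnorm_le => e e0.
  move/cvgr0Pnorm_le : hC => /(_ e e0); apply: filter_app.
  near=> h; apply: le_trans; rewrite /= [flat m 0]flat_le0// subr0 addr0.
  have h0 : h != 0 by near: h; exact: nbhs_dnbhs_neq.
  rewrite /GRing.scale/= mulr1 normrM normfV ler_pdivrMl ?normr_gt0//.
  apply: le_trans (flat_le_sqr _ _) _.
  rewrite normrM [`|C|]ger0_norm ?exprn_ge0// [leRHS]mulrCA -expr2.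
  by rewrite real_normK ?num_real.
Unshelve. all: by end_near. Qed.

End Flat.

(** * Compositions with smooth functions *)

Section CkComposition.
Context {R : realType} {n : nat}.
Implicit Types (A : set 'rV[R]_n) (f : 'rV[R]_n -> R).

Lemma differentiable_compR f (g : R -> R) (d : R) p :
  differentiable f p -> is_derive (f p) 1 g d ->
  differentiable (fun q => g (f q)) p
  /\ forall v, 'D_v (fun q => g (f q)) p = d * 'D_v f p.
Proof.
move=> df [dg gd].
have dg' : differentiable g (f p) by exact/derivable1_diffP.
have dc : differentiable (g \o f) p by exact: differentiable_comp.
split=> // v; rewrite -[LHS]/('D_v (g \o f) p) !deriveE// diff_comp//=.
by rewrite diff1E// derive1E gd /GRing.scale/= mulrC.
Qed.

Lemma Ck_flat k m A f : open A -> Ck k A f -> Ck k A (fun p => flat m (f p)).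
Proof.
move=> oA; elim: k m f => [|k IH] m f hf.
  move=> p Ap; apply: (@continuous_comp _ _ _ f (flat m)); first exact: hf.
  apply/differentiable_continuous/derivable1_diffP.
  by case: (is_derive_flat m (f p)).
have hf' := CkW hf; case: hf => df Df.
have dfl p : A p -> _ := fun Ap => differentiable_compR (df p Ap)
  (is_derive_flat m (f p)).
split=> [p /dfl[]//|v].
apply: Ck_ext (Ck_mul oA (Ck_add oA (IH m.+2 f hf')
  (Ck_mul oA (Ck_cst k A (- m%:R)) (IH m.+1 f hf'))) (Df v)) => // p Ap.
by rewrite (dfl p Ap).2 mulNr.
Qed.

Lemma Ck_inv k A f : open A -> (forall p, A p -> f p != 0) ->
  Ck k A f -> Ck k A (fun p => (f p)^-1).
Proof.
move=> oA f0; elim: k f f0 => [|k IH] f f0 hf.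
  by move=> p Ap; apply: continuousV; [exact: f0|exact: hf].
have hi := IH f f0 (CkW hf); case: hf => df Df.
split=> [p Ap|v]; first by apply: differentiableV; [exact: df|exact: f0].
apply: Ck_ext (Ck_mul oA (Ck_mul oA (Ck_mul oA (Ck_cst k A (-1)) hi) hi)
  (Df v)) => // p Ap.
rewrite deriveV ?f0//; last exact/diff_derivable/df.
by rewrite /GRing.scale/= mulN1r mulNr -invfM.
Qed.

End CkComposition.

(** * Bump functions on a manifold *)

(** The open set [W] says, without a closure, that the topological support of
    [h] lies in [U]. *)
Definition supported_in (R : realType) (M : manifold R) (h : cinf M)
    (U : set M) :=
  exists W : set M, [/\ open W, forall y, U y \/ W y
    & forall y, W y -> h y = 0].

Section BumpFunctions.
Context {R : realType} {M : manifold R}.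
Implicit Types (A U V W : set M) (f h : cinf M).

Lemma smoothM_flat m A (g : M -> R) : open A -> smoothM A g ->
  smoothM A (fun x => flat m (g x)).
Proof. by move=> oA hg c k; apply: Ck_flat (hg c k); exact: open_cimg. Qed.

Lemma smoothM_inv A (g : M -> R) : open A -> (forall x, A x -> g x != 0) ->
  smoothM A g -> smoothM A (fun x => (g x)^-1).
Proof.
move=> oA g0 hg c k; apply: Ck_inv (hg c k); first exact: open_cimg.
by move=> p [_ /g0].
Qed.

Lemma smoothM_prod A (I : finType) (g : I -> M -> R) : open A ->
  (forall i, smoothM A (g i)) -> smoothM A (fun x => \prod_i g i x).
Proof.
move=> oA hg; elim: (index_enum I) => [|i s IH].
  by apply: smoothM_ext (smoothM_cst A 1) => // x _; rewrite big_nil.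
by apply: smoothM_ext (smoothM_mul oA (hg i) IH) => // x _; rewrite big_cons.
Qed.

Lemma smoothM_chart (c : cidx M) k : smoothM (cdom c) (fun x => chart c x 0 k).
Proof. by move=> c'; exact: chart_smooth. Qed.

(** In a chart, a product of one-dimensional bumps in the coordinates vanishes
    outside a closed box inside the image of the chart. The box is compact, so
    its image in the Hausdorff space [M] is closed, and the extension by zero
    is smooth. *)
Lemma exists_bump U x : open U -> U x ->
  exists2 h : cinf M, h x != 0 & supported_in h U.
Proof.
move=> oU Ux; have [c cx] := cdom_cover x.
pose p0 := chart c x.
pose O := cimg c `&` @chartV R M c @^-1` U.
have Op0 : nbhs p0 O.
  apply: open_nbhs_nbhs; split; first exact: open_cimg.
  by split; [exact: chart_img|rewrite /= chartK].
have [e /= e0 eO] := (nbhs_ballP _ _).1 Op0.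
(* Halving makes the closed box of radius [r] fit in the open ball. *)
pose r := e / 2.
have r0 : 0 < r by rewrite divr_gt0.
pose Q := [set p : 'rV[R]_(Defs.dim M) |
  forall k, `[p0 0 k - r, p0 0 k + r]%classic (p 0 k)].
have QO : Q `<=` O.
  move=> p Qp; apply: eO; split=> // i k; rewrite ord1 /ball/= ltr_norml.
  have := Qp k; rewrite /= in_itv/= /r => /andP[h1 h2].
  by apply/andP; split; lra.
pose K := @chartV R M c @` Q.
have cK : closed K.
  apply: compact_closed; first exact: carrier_hausdorff.
  apply: continuous_compact.
    apply: continuous_in_subspaceT => p /set_mem/QO[cp _].
    exact: chartV_continuous.
  apply: (@rV_compact R _ (fun k => `[p0 0 k - r, p0 0 k + r]%classic)) => k.
  exact: segment_compact.
pose b y := \prod_k (flat 0 (r - (chart c y 0 k - p0 0 k))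
  * flat 0 (r + (chart c y 0 k - p0 0 k))).
have oc := @cdom_open _ M c.
have hb : smoothM (cdom c) b.
  apply: smoothM_prod => // k.
  have hq : smoothM (cdom c) (fun y => chart c y 0 k - p0 0 k).
    exact: smoothM_add oc (@smoothM_chart c k) (smoothM_cst _ _).
  have hr := smoothM_cst (cdom c) r.
  apply: smoothM_mul => //; apply: smoothM_flat => //; apply: smoothM_add => //.
  exact: smoothM_opp.
pose h y := if `[< cdom c y >] then b y else 0.
have hK y : ~ K y -> h y = 0.
  rewrite /h; case: asboolP => // cy nK.
  have [k nk] : exists k, ~ `[p0 0 k - r, p0 0 k + r]%classic (chart c y 0 k).
    apply/existsNP => Qy; apply: nK; exists (chart c y) => //; exact: chartK.
  rewrite /b (bigD1 k)//=.
  have [h1|h1] := leP (chart c y 0 k) (p0 0 k + r); last first.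
    by rewrite [flat 0 _]flat_le0 ?mul0r ?mul0r// subr_le0 lerBrDl ltW.
  have [h2|h2] := leP (p0 0 k - r) (chart c y 0 k); last first.
    have le0 : r + (chart c y 0 k - p0 0 k) <= 0.
      by rewrite addrA lerBlDr add0r addrC -lerBrDr ltW.
    by rewrite (flat_le0 _ le0) mulr0 mul0r.
  by case: nk; rewrite /= in_itv/= h1 h2.
have oK : open (~` K) by exact: closed_openC.
have sh : smoothM setT h.
  apply: smoothM_loc => y _; have [cy|ncy] := pselect (cdom c y).
    exists (cdom c); split=> //; apply: smoothM_ext hb => // z cz.
    by rewrite /h asboolT.
  exists (~` K); split; last first.
    by apply: smoothM_ext (smoothM_cst _ 0) => // z /hK.
  by move=> [p /QO[cp _] py]; apply: ncy; rewrite -py; exact: chartV_dom.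
exists (Cinf sh) => /=.
  rewrite /h asboolT//; apply/prodf_neq0 => k _.
  by rewrite subrr subr0 addr0 mulf_neq0// gt_eqF// flat_gt0.
exists (~` K); split=> //.
move=> y; have [|] := pselect (K y); last by right.
by move=> [p /QO[_ Up] <-]; left.
Qed.

Lemma cinf_continuous f : continuous (f : M -> R).
Proof.
move=> x; have [c cx] := cdom_cover x.
have ncx : nbhs x (cdom c) by exact: open_nbhs_nbhs (conj (cdom_open c) cx).
have fK : {near x, f \o chartV c \o chart c =1 f}.
  by apply: filterS ncx => y cy /=; rewrite chartK.
rewrite /continuous_at -[X in _ --> f X](chartK cx).
apply: cvg_trans (near_eq_cvg fK) _.
apply: (@continuous_comp _ _ _ (chart c) (f \o chartV c)).
  exact: chart_continuous.
by apply: (@cinf_smooth _ _ f c 0); split=> //; exact: chart_img.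
Qed.

Lemma supported_inS h U V : U `<=` V -> supported_in h U -> supported_in h V.
Proof.
move=> UV [W [oW UW hW]]; exists W; split=> // y.
by have [/UV|] := UW y; [left|right].
Qed.

Lemma smoothM_cutoff h U A (g : M -> R) :
  supported_in h U -> open U -> open A ->
  smoothM (A `&` U) g -> smoothM A (fun x => h x * g x).
Proof.
move=> [W [oW UW hW]] oU oA sg; apply: smoothM_loc => x Ax.
have [Ux|Wx] := UW x.
  exists (A `&` U); split=> //; apply: smoothM_mul => //; first exact: openI.
  exact: smoothM_sub (cinf_smooth h).
exists W; split=> //; apply: smoothM_ext (smoothM_cst _ 0) => // y /hW ->.
by rewrite mul0r.
Qed.

End BumpFunctions.

(** * Global sections from local frames *)

Section CutoffSections.
Context {R : realType} {M : manifold R} {E : bundle M}.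
Implicit Types h : cinf M.

Fact cutoff_coord_smooth h (i : tidx E) (s : section E) k :
  supported_in h (tdom i) ->
  smoothM setT (fun x => h x * triv i x (s x) 0 k).
Proof.
move=> hi; apply: smoothM_cutoff hi _ _ _ => //; first exact: tdom_open.
  exact: openT.
exact: section_smooth.
Qed.

Fact cutoff_frame_smooth h (i : tidx E) w : supported_in h (tdom i) ->
  smoothS setT (fun x => h x *: trivV i x w : E x).
Proof.
move=> hi j k; have oA : open (setT `&` tdom j) := open_tdom j openT.
have sg : smoothM ((setT `&` tdom j) `&` tdom i)
    (fun x => triv j x (trivV i x w) 0 k).
  by apply: smoothM_sub (@triv_smooth _ _ E i j w k) => x [[_ ?] ?].
apply: smoothM_ext (smoothM_cutoff hi (tdom_open i) oA sg) => // x _.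
by rewrite linearZ mxE.
Qed.

Definition cutoff_coord h (i : tidx E) (s : section E) k
    (hi : supported_in h (tdom i)) : cinf M :=
  Cinf (cutoff_coord_smooth s k hi).

Definition cutoff_frame h (i : tidx E) w (hi : supported_in h (tdom i)) :
  section E := Section (cutoff_frame_smooth w hi).

Lemma section_sumE (I : finType) (s : I -> section E) x :
  (\sum_k s k) x = \sum_k s k x.
Proof. by apply: (big_morph (fun t : section E => t x)). Qed.

Lemma section_through x (u : E x) : exists s : section E, s x = u.
Proof.
have [i ix] := tdom_cover E x.
have [h hx hi] := exists_bump (tdom_open i) ix.
exists (cinf_cst (h x)^-1 *: cutoff_frame (triv i x u) hi) => /=.
by rewrite scalerA mulVf// scale1r trivK.
Qed.

Definition extend x (u : E x) : section E := sval (cid (section_through u)).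

Lemma extendE x (u : E x) : extend u x = u.
Proof. exact: svalP (cid (section_through u)). Qed.

End CutoffSections.

(** * Operations on sections that are linear over functions are tensors *)

Section Tensoriality.
Context {R : realType} {M : manifold R} {F E : bundle M}.

(** If [r] vanishes at [x] and [h] is a bump at [x] supported in the domain of
    a frame [e_k], then [h^2 r] is the sum of the [(h r_k) (h e_k)], where the
    coordinates [r_k] of [r] vanish at [x]; apply [phi] and divide by
    [h(x)^2]. *)
Lemma tensorial_at (phi : section F -> section E) (s t : section F) x :
  linear phi -> s x = t x -> phi s x = phi t x.
Proof.
move=> lphi.
pose Phi : {linear section F -> section E} :=
  HB.pack phi (GRing.isLinear.Build (cinf M) (section F) (section E) _ phi lphi).
suff phi0 (r : section F) : r x = 0 -> Phi r x = 0.
  move=> st; apply/eqP; rewrite -subr_eq0; apply/eqP.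
  have := phi0 (s - t); rewrite linearB /=; apply.
  by rewrite st subrr.
move=> rx; have [i ix] := tdom_cover F x.
have [h hx hi] := exists_bump (tdom_open i) ix.
have hr : h * h *: r = \sum_k
    cutoff_coord r k hi *: cutoff_frame (delta_mx 0 k) hi.
  have [W [_ UW hW]] := hi.
  apply: sectionP => y; rewrite section_sumE /=.
  have [iy|/hW hy] := UW y; last first.
    by rewrite hy mul0r scale0r big1// => k _; rewrite !mul0r scale0r.
  rewrite [r y in LHS](section_frame r iy) scaler_sumr.
  by apply: eq_bigr => k _; rewrite !scalerA; congr (_ *: _); ring.
have : Phi (h * h *: r) x = 0.
  rewrite hr linear_sum section_sumE big1// => k _.
  by rewrite linearZ /= rx linear0 mxE mulr0 scale0r.
by rewrite linearZ /= => /eqP; rewrite scaler_eq0 mulf_eq0 (negbTE hx) => /eqP.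
Qed.

Section Bilinear.
Context (phi : section F -> section F -> section E).
Context (phil : forall t, linear (phi^~ t)) (phir : forall s, linear (phi s)).

Lemma bitensorial_at (s s' t t' : section F) x :
  s x = s' x -> t x = t' x -> phi s t x = phi s' t' x.
Proof.
move=> ss tt; rewrite (tensorial_at (phir s) tt).
exact: (tensorial_at (phil t') ss).
Qed.

Definition tensor_fun x (u v : F x) : E x := phi (extend u) (extend v) x.

Lemma tensor_funE (s t : section F) x : tensor_fun (s x) (t x) = phi s t x.
Proof. by apply: bitensorial_at; rewrite extendE. Qed.

Fact tensor_linearl x (v : F x) : linear (fun u : F x => tensor_fun u v).
Proof.
move=> a u u'; rewrite -[RHS]/((cinf_cst a *: phi (extend u) (extend v)
  + phi (extend u') (extend v)) x) -phil.
by apply: bitensorial_at => //=; rewrite !extendE.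
Qed.

Fact tensor_linearr x (u : F x) : linear (tensor_fun u).
Proof.
move=> a v v'; rewrite -[RHS]/((cinf_cst a *: phi (extend u) (extend v)
  + phi (extend u) (extend v')) x) -phir.
by apply: bitensorial_at => //=; rewrite !extendE.
Qed.

(** The extensions chosen in [tensor_fun] do not vary smoothly with the point.
    Near a given point they can be replaced by the cut off frames [S] and [T],
    which differ from the frames by the invertible smooth factor [h]. *)
Fact tensor_smooth (i j : tidx F) w w' :
  smoothS (tdom i `&` tdom j)
    (fun x => tensor_fun (trivV i x w) (trivV j x w')).
Proof.
move=> l k; apply: smoothM_loc => x [[ix jx] lx].
have oij : open (tdom i `&` tdom j) by exact: openI (tdom_open i) (tdom_open j).
have [h hx hij] := exists_bump oij (conj ix jx).
have hi := supported_inS (@subIsetl _ _ _) hij.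
have hj := supported_inS (@subIsetr _ _ _) hij.
pose S := cutoff_frame w hi; pose T := cutoff_frame w' hj.
pose B := tdom l `&` (h @^-1` [set r : R | r != 0]).
have oB : open B.
  apply: openI; first exact: tdom_open.
  apply: open_comp => [y _|]; first exact: cinf_continuous.
  exact: open_neq.
exists B; split; first by split.
have shV : smoothM B (fun y => (h y)^-1).
  apply: smoothM_inv => //; first by move=> y [].
  exact: smoothM_sub (cinf_smooth h).
have sST : smoothM B (fun y => triv l y (phi S T y) 0 k).
  by apply: smoothM_sub (section_smooth (phi S T) k) => y [].
apply: smoothM_ext (smoothM_mul oB shV (smoothM_mul oB shV sST)) => // y [_ hy].
rewrite -tensor_funE /=.
rewrite (scalable_linear (tensor_linearr _)).
rewrite (scalable_linear (tensor_linearl _)) !linearZ /= !mxE.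
by field.
Qed.

Definition tensor_bilmap : bilmap F E :=
  Bilmap tensor_linearl tensor_linearr tensor_smooth.

Lemma tensor_bilmapE s t : bil_section tensor_bilmap s t = phi s t.
Proof. by apply: sectionP => x /=; rewrite tensor_funE. Qed.

End Bilinear.
End Tensoriality.

(** * Additivity and antisymmetry of the operations on sections *)

Section SectionOperations.
Context {R : realType} {M : manifold R}.

(** Real-valued functionals turn an identity between sums of sections into one
    between real numbers, where [ring] applies. *)
Lemma section_sep (E : bundle M) (s t : section E) :
  (forall phi : {additive section E -> R}, phi s = phi t) -> s = t.
Proof.
move=> st; apply: sectionP => x.
have [i ix] := tdom_cover E x.
apply: (can_inj (trivK ix)); apply/rowP => k.
pose phi (r : section E) : R := triv i x (r x) 0 k.
have phiB : zmod_morphism phi.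
  by move=> r r'; rewrite /phi /= linearB !mxE.
exact: (st (HB.pack phi (GRing.isZmodMorphism.Build _ _ phi phiB))).
Qed.

Lemma zmod_morphismE (U V : zmodType) (f : U -> V) : zmod_morphism f ->
  (forall x, f (- x) = - f x) * (forall x y, f (x + y) = f x + f y).
Proof.
move=> fB; pose g : {additive U -> V} :=
  HB.pack f (GRing.isZmodMorphism.Build _ _ f fB).
by split; [exact: (raddfN g)|exact: (raddfD g)].
Qed.

Lemma biadditive_antisym (U V : zmodType) (b : U -> U -> V) :
  (forall t, zmod_morphism (b^~ t)) -> (forall s, zmod_morphism (b s)) ->
  (forall s, b s s = 0) -> forall s t, b s t = - b t s.
Proof.
move=> bl br b0 s t; apply/eqP; rewrite -addr_eq0; apply/eqP.
have := b0 (s - t).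
by rewrite br !bl !b0 sub0r subr0 -opprD => /eqP; rewrite oppr_eq0 addrC => /eqP.
Qed.

Lemma Rlinear_zmod (E E' : bundle M) (phi : section E -> section E') :
  Rlinear phi -> zmod_morphism phi.
Proof.
move=> phiL s t.
have e (E0 : bundle M) (r : section E0) : cinf_cst (-1) *: r = - r.
  by apply: sectionP => x /=; rewrite scaleN1r.
by rewrite addrC -e phiL e addrC.
Qed.

Lemma bmap_section_linear (E F : bundle M) (K : bmap E F) :
  linear (bmap_section K).
Proof. by move=> f t t'; apply: sectionP => x /=; rewrite linearP. Qed.

Section Bilmap.
Context {F E : bundle M} (B : bilmap F E).

Lemma bil_section_linearl t : linear (bil_section B ^~ t).
Proof. by move=> f s s'; apply: sectionP => x /=; rewrite bil_linearl. Qed.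

Lemma bil_section_linearr s : linear (bil_section B s).
Proof. by move=> f t t'; apply: sectionP => x /=; rewrite bil_linearr. Qed.

Lemma bil_section_antisym : (forall s, bil_section B s s = 0) ->
  forall s t, bil_section B s t = - bil_section B t s.
Proof.
by apply: biadditive_antisym => r; apply: zmod_morphism_linear;
  [exact: bil_section_linearl|exact: bil_section_linearr].
Qed.

End Bilmap.

Lemma form2_section_alt (F E : bundle M) (z : form2 F E) X :
  bil_section z X X = 0.
Proof. by apply: sectionP => x /=; rewrite form2_alt. Qed.

Lemma bracket_antisym (A : algebroid M) (s t : section A) :
  bracket s t = - bracket t s.
Proof.
apply: biadditive_antisym => [r|r|r]; last exact: bracket_alt.
  by apply: Rlinear_zmod; exact: bracket_linearl.
by apply: Rlinear_zmod; exact: bracket_linearr.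
Qed.

End SectionOperations.

(** * Obstructions to the adjustment and strict YM equations *)

Section Identities.
Context {R : realType} {M : manifold R} {E F : algebroid M}.
Context (K : algebroid_morphism E F) (D D' : connection F E) (z : form2 F E).
Context (H : bilmap E E).

Local Notation k := (bmap_section K).
Local Notation h := (bil_section H).
Local Notation w := (bil_section z).

Context (H_alt : forall s, h s s = 0).
Context (D_shift : forall X s, D X s = D' X s + w X (k s)).
Context (E_bracket : forall s t,
  bracket s t = h s t + D' (k s) t - D' (k t) s + w (k s) (k t)).

Let hl t := zmod_morphismE (zmod_morphism_linear (bil_section_linearl H t)).
Let hr t := zmod_morphismE (zmod_morphism_linear (bil_section_linearr H t)).
Let wl t := zmod_morphismE (zmod_morphism_linear (bil_section_linearl z t)).
Let wr t := zmod_morphismE (zmod_morphism_linear (bil_section_linearr z t)).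
Let Dl t := zmod_morphismE (zmod_morphism_linear (nabla_linearl D' t)).
Let Dr t := zmod_morphismE (Rlinear_zmod (nabla_linearr D' t)).
Let Fl (t : section F) := zmod_morphismE (Rlinear_zmod (bracket_linearl t)).
Let Fr (t : section F) := zmod_morphismE (Rlinear_zmod (bracket_linearr t)).
Let kD := zmod_morphismE (zmod_morphism_linear (bmap_section_linear K)).
Let expand := (hl, hr, wl, wr, Dl, Dr, Fl, Fr, kD, mor_bracket).

Let hC := bil_section_antisym H_alt.
Let wC := bil_section_antisym (form2_section_alt z).
Let FC := @bracket_antisym _ _ F.

Definition curvature_defect X Y s := curvature D' X Y s - h (w X Y) s.

Definition invariance_defect X s t :=
  D' X (h s t) - h (D' X s) t - h s (D' X t).

(** Here [basicE K D s t] is just [h s t + D' (k s) t]: the terms in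
    [D' (k t) s] cancel, and so do the two terms in [z]. In this proof and the
    next two, both sides are expanded into sums of iterated operations, and
    antisymmetry gives a common form to terms that differ by a swap. *)
Lemma adjustment_curvature X Y s :
  curvature D X Y s
  = - basicE K D s (w X Y) + w (basicF K D s X) Y + w X (basicF K D s Y)
    + (curvature_defect X Y s + dnabla D' z X Y (k s)).
Proof.
rewrite /curvature_defect /dnabla /curvature /basicE /basicF.
rewrite !D_shift !E_bracket !expand.
rewrite (hC s) (wC (k s) (k _)) (wC (k s) X) (wC X (bracket _ _)).
rewrite (wC (k (D' X s))) (wC (k (w X (k s)))) (FC Y (k s)) !expand.
apply: section_sep => phi; rewrite !(zmod_morphismE (raddfB phi)); ring.
Qed.

(** Since [K] preserves brackets, [z X (k [s, t])] becomes the term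
    [z X [k s, k t]] of [dnabla D' z X (k s) (k t)]. The curvature terms come
    from the second derivatives of [s] and [t] along [X] and the images of
    [K]. *)
Lemma adjustment_Cartan s t X :
  D X (bracket s t) - bracket (D X s) t - bracket s (D X t)
    - D (basicF K D t X) s + D (basicF K D s X) t
  = invariance_defect X s t + curvature_defect X (k s) t
    - curvature_defect X (k t) s + dnabla D' z X (k s) (k t).
Proof.
rewrite /curvature_defect /invariance_defect /dnabla /curvature /basicE /basicF.
rewrite !D_shift !mor_bracket !E_bracket !expand.
rewrite (hC s (w _ _)) (wC (k s) (k (D' _ _))) (wC (k s) (k (w _ _))).
rewrite (wC X (bracket _ _)) (wC (k t) X) (FC X (k s)) (FC X (k t)) !expand.
apply: section_sep => phi; rewrite !(zmod_morphismE (raddfB phi)); ring.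
Qed.

Lemma bracket_jacobiator s t u :
  bracket s (bracket t u) + bracket t (bracket u s) + bracket u (bracket s t)
  = (h s (h t u) + h t (h u s) + h u (h s t))
    + (invariance_defect (k s) t u + invariance_defect (k t) u s
       + invariance_defect (k u) s t)
    + (curvature_defect (k s) (k t) u + curvature_defect (k t) (k u) s
       + curvature_defect (k u) (k s) t)
    + dnabla D' z (k s) (k t) (k u).
Proof.
rewrite /curvature_defect /invariance_defect /dnabla /curvature.
(* Outer brackets come first: the inner ones under [k] are to become brackets
   of [F] by [mor_bracket], not sums. *)
rewrite !(E_bracket _ (bracket _ _)) !mor_bracket !E_bracket !expand.
rewrite (hC (D' (k s) t)) (hC (D' (k t) u)) (hC (D' (k u) s)).
rewrite (hC (w (k s) (k t))) (hC (w (k t) (k u))) (hC (w (k u) (k s))).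
rewrite (wC (k s) (bracket _ _)) (wC (k t) (bracket _ _)).
rewrite (wC (k u) (bracket _ _)).
apply: section_sep => phi; rewrite !(zmod_morphismE (raddfB phi)); ring.
Qed.

End Identities.

(** * Changing the connection and reading off the bracket field *)

Section ShiftConnection.
Context {R : realType} {M : manifold R} {F : algebroid M} {E : bundle M}.
Context (D : connection F E) (B : section F -> section E -> section E).
Context (Bl : forall s, linear (B^~ s)) (Br : forall X, linear (B X)).

Fact shift_linearl s : linear (fun X => D X s + B X s).
Proof. by move=> f X Y; rewrite nabla_linearl Bl scalerDr addrACA. Qed.

Fact shift_linearr X : Rlinear (fun s => D X s + B X s).
Proof. by move=> r s t; rewrite nabla_linearr Br scalerDr addrACA. Qed.

Fact shift_leibniz X f s : D X (f *: s) + B X (f *: s)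
  = f *: (D X s + B X s) + anchor_section (anchor F) X f *: s.
Proof. by rewrite nabla_leibniz (scalable_linear (Br X)) scalerDr addrAC. Qed.

Definition shift_connection : connection F E :=
  Connection shift_linearl shift_linearr shift_leibniz.

End ShiftConnection.

Section BracketRemainder.
Context {R : realType} {M : manifold R} {E F : algebroid M}.
Context (K : algebroid_morphism E F) (D : connection F E) (z : form2 F E).
Local Notation k := (bmap_section K).
Local Notation w := (bil_section z).

(** The twisted action formula solved for its bracket field. *)
Definition bracket_remainder (s t : section E) : section E :=
  bracket s t - D (k s) t + D (k t) s - w (k s) (k t).

Lemma bracket_remainder_alt s : bracket_remainder s s = 0.
Proof.
by rewrite /bracket_remainder bracket_alt form2_section_alt sub0r addNr subr0.
Qed.

Lemma bracket_remainder_antisym s t :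
  bracket_remainder s t = - bracket_remainder t s.
Proof.
rewrite /bracket_remainder bracket_antisym.
rewrite (bil_section_antisym (form2_section_alt z) (k s)).
by rewrite !(opprD, opprK) (addrAC (- bracket t s)).
Qed.

(** The derivatives of [f] along [s] for the anchor of [E] and along [K s] for
    the anchor of [F] agree, so the Leibniz terms of the bracket and of
    [D (k s)] cancel. *)
Lemma bracket_remainder_linearr s : linear (bracket_remainder s).
Proof.
have brD := zmod_morphismE (Rlinear_zmod (bracket_linearr s)).
have DD := zmod_morphismE (Rlinear_zmod (nabla_linearr D (k s))).
move=> f t u; rewrite /bracket_remainder brD DD !bmap_section_linear.
rewrite nabla_linearl bil_section_linearr bracket_leibniz nabla_leibniz.
have -> : anchor_section (anchor E) s f = anchor_section (anchor F) (k s) f.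
  by apply: cinfP => x /=; rewrite mor_anchor.
apply: section_sep => phi.
by rewrite !(scalerDr, scalerN) !(zmod_morphismE (raddfB phi)); ring.
Qed.

Lemma bracket_remainder_linearl t : linear (bracket_remainder^~ t).
Proof.
move=> f s u; rewrite bracket_remainder_antisym bracket_remainder_linearr.
by rewrite opprD -scalerN -!bracket_remainder_antisym.
Qed.

End BracketRemainder.

(** * The correspondence *)

Section Correspondence.
Context {R : realType} {M : manifold R} {E F : algebroid M}.
Context (K : algebroid_morphism E F).
Local Notation k := (bmap_section K).

Lemma YM_adjustment (H : bla E) (D : connection F E) (z : form2 F E) :
  strict_YM H D z -> twisted_action K H D z ->
  exists D' : connection F E, strict_adjustment K D' z.
Proof.
move=> [inv curv dz] [_ br].
have Bl s : linear (fun X => bil_section z X (k s)).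
  by move=> f X Y; rewrite bil_section_linearl.
have Br X : linear (fun s => bil_section z X (k s)).
  by move=> f s t; rewrite bmap_section_linear bil_section_linearr.
pose D' := shift_connection D Bl Br.
have Halt s : bil_section H s s = 0.
  by apply: sectionP => x /=; rewrite bla_alt.
have i0 X s t : invariance_defect D H X s t = 0.
  by rewrite /invariance_defect inv addrAC addrK subrr.
have c0 X Y s : curvature_defect D z H X Y s = 0.
  by rewrite /curvature_defect curv subrr.
have D'E X s : D' X s = D X s + bil_section z X (k s) by [].
exists D'; split.
- move=> s t X; rewrite (adjustment_Cartan Halt D'E br) i0 !c0 dz.
  by rewrite !addr0 subrr.
- by move=> X Y s; rewrite (adjustment_curvature Halt D'E br) c0 dz !addr0.
- have -> : nabla_form K D' z = D; last exact: dz.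
  by apply/funext => X; apply/funext => s; rewrite /nabla_form D'E addrK.
Qed.

Lemma adjustment_YM (D : connection F E) (z : form2 F E) :
  strict_adjustment K D z ->
  exists (H : bla E) (D' : connection F E),
    strict_YM H D' z /\ twisted_action K H D' z.
Proof.
move=> [cart curv dz].
have Bl s : linear (fun X => - bil_section z X (k s)).
  by move=> f X Y; rewrite bil_section_linearl opprD scalerN.
have Br X : linear (fun s => - bil_section z X (k s)).
  by move=> f s t; rewrite bmap_section_linear bil_section_linearr opprD scalerN.
pose D' := shift_connection D Bl Br.
have DE X s : D X s = D' X s + bil_section z X (k s) by rewrite /= subrK.
pose H := tensor_bilmap (bracket_remainder_linearl K D' z)
  (bracket_remainder_linearr K D' z).
have HE s t : bil_section H s t = bracket_remainder K D' z s t.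
  exact: tensor_bilmapE.
have br s t : bracket s t = bil_section H s t + D' (k s) t - D' (k t) s
    + bil_section z (k s) (k t).
  rewrite HE /bracket_remainder; apply: section_sep => phi.
  by rewrite !(zmod_morphismE (raddfB phi)); ring.
have Halt s : bil_section H s s = 0 by rewrite HE bracket_remainder_alt.
(* [D'] and [nabla_form K D z] are convertible. *)
have dz' X Y Z : dnabla D' z X Y Z = 0 by exact: dz.
have c0 X Y s : curvature_defect D' z H X Y s = 0.
  have := adjustment_curvature Halt DE br X Y s; rewrite curv dz' addr0.
  by rewrite -[LHS]addr0 => /addrI/esym.
have i0 X s t : invariance_defect D' H X s t = 0.
  have := adjustment_Cartan Halt DE br s t X.
  by rewrite cart !c0 dz' !addr0 subr0 => <-.
have jac s t u : bil_section H s (bil_section H t u)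
    + bil_section H t (bil_section H u s)
    + bil_section H u (bil_section H s t) = 0.
  have := bracket_jacobiator Halt br s t u.
  by rewrite bracket_jacobi !i0 !c0 dz' !addr0 => <-.
have Halt_pt x (u : E x) : H x u u = 0.
  rewrite -(extendE u).
  exact: (congr1 (fun r : section E => r x) (Halt (extend u))).
have jac_pt x (u v y : E x) :
    H x u (H x v y) + H x v (H x y u) + H x y (H x u v) = 0.
  rewrite -(extendE u) -(extendE v) -(extendE y).
  exact: (congr1 (fun r : section E => r x)
    (jac (extend u) (extend v) (extend y))).
exists (Bla Halt_pt jac_pt), D'; split; first split => //=.
- move=> X s t; have /eqP := i0 X s t.
  by rewrite /invariance_defect -addrA -opprD subr_eq0 => /eqP.
- by move=> X Y s; apply/eqP; rewrite -subr_eq0; apply/eqP/c0.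
- by split=> // x u f; rewrite mor_anchor.
Qed.

End Correspondence.

Theorem corollary2p7 (R : realType) (M : manifold R) (E F : algebroid M)
    (K : algebroid_morphism E F) :
  (exists (H : bla E) (D : connection F E) (z : form2 F E),
      strict_YM H D z /\ twisted_action K H D z) <->
  (exists (D : connection F E) (z : form2 F E), strict_adjustment K D z).
Proof.
split=> [[H [D [z [YM tw]]]]|[D [z adj]]].
  by have [D' adj] := YM_adjustment YM tw; exists D', z.
by have [H [D' YM]] := adjustment_YM adj; exists H, D', z.
Qed.
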